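(* Let $\gamma$ denote Euler's constant. Euler's constant $\gamma$ is a rational number if and only if there exists an integer $N$ such that for all integers $n\ge N$ and all integers $m$ with $2^{n-1}\le m\le 2^{n+1}$, the fractional part of $d_{2^n}L_{n,m}$ equals $d_{2^n}I_{n,m}$, i.e. $\{d_{2^n}L_{n,m}\}=d_{2^n}I_{n,m}$.
   Context: $d_N$ denotes the least common multiple of $1,2,\dots,N$, and $\{x\}$ the fractional part of $x$. For real $q>1$ the $q$-logarithm is $\ln_q(1+z)=\sum_{\mu=1}^\infty \frac{(-1)^{\mu-1}z^\mu}{q^\mu-1}$ for $|z|<q$. For an integer $m\ge0$ let $R_m(t)=\frac{m!}{t(t+1)\cdots(t+m)}$; for integers $\nu\ge0$ let $S_{\nu,m}=\sum_{t=0}^\infty(-1)^tR_m(2^\nu+t)$, and for integers $n\ge0$ let $I_{n,m}=\sum_{\nu=n+1}^\infty S_{\nu,m}$. For integers $n\ge0$ and $0\le m\le 2^{n+1}$ define $$L_{n,m}=2^m n\log 2+\sum_{j=2}^m\binom mj\sum_{k=1}^{j-1}\frac{(-1)^{k-1}}k\ln_2\Big(1+\frac k{2^n}\Big),$$ $$A_{n,m}=\frac{2^m-1}{2^n}+2^m\sum_{\nu=1}^n\sum_{l=1}^{2^\nu-1}\frac{(-1)^{l-1}}l.$$ Empty sums are zero. *)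

(* Defs.v *)
From Stdlib Require Import Arith Reals List QArith Qreals.
From Coquelicot Require Import Coquelicot.
Open Scope R_scope.

(* [sum_n_m u a b] is the sum over a <= k <= b, and is 0 when b < a. *)

Definition euler_gamma : R :=
  real (Lim_seq (fun n => sum_n_m (fun k => / INR k) 1 n - ln (INR n))).

Definition is_rational (x : R) : Prop := exists r : Q, x = Q2R r.

Definition lcm_upto (N : nat) : nat := fold_right Nat.lcm 1%nat (seq 1 N).

(* As a function of x = 1 + z; the summation index is i = mu - 1.  The series
   converges for |x - 1| < q, where q > 1. *)
Definition q_ln (q x : R) : R :=
  Series (fun i => (-1) ^ i * (x - 1) ^ S i / (q ^ S i - 1)).

Definition R_frac (m : nat) (t : R) : R :=
  INR (fact m) / prod_f_R0 (fun i => t + INR i) m.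

Definition S_sum (nu m : nat) : R :=
  Series (fun t => (-1) ^ t * R_frac m (2 ^ nu + INR t)).

Definition I_sum (n m : nat) : R :=
  Series (fun i => S_sum (n + 1 + i) m).

(* [Binomial.C] is the binomial coefficient as a real number; the bare name [C]
   is Coquelicot's type of complex numbers. *)
Definition L_sum (n m : nat) : R :=
  2 ^ m * INR n * ln 2 +
  sum_n_m (fun j =>
    Binomial.C m j *
    sum_n_m (fun k =>
      (-1) ^ (k - 1) / INR k * q_ln 2 (1 + INR k / 2 ^ n)) 1 (j - 1)) 2 m.

(* Main.v *)
(* Partial fractions, the alternating series of ln 2 and Vacca's series for
   gamma give I_{n,m} = 2^m gamma + L_{n,m} - A_{n,m}, where d_{2^n} A_{n,m} is
   an integer.  Hence d_{2^n} (I_{n,m} - L_{n,m}) is an integer as soon as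
   2^m d_{2^n} gamma is, which for rational gamma holds once 2^n exceeds the
   denominator; conversely one such pair (n, m) makes gamma rational.

   It remains to see that 0 <= d_{2^n} I_{n,m} < 1 for large n.  Put
   M = 2^(n-1).  The alternating sums give
   0 <= I_{n,m} <= M! (4M)! / (5M)! <= (M + 1)^2 / 12^M, so the bound
   d_N <= 4^N is too weak for N = 2M.  Chebyshev's method with the quotient
   N! / ((N/2)! (N/3)! (N/6)!) gives d_N <= (N + 1)^O(log N) 432^(N/5), and
   432^2 < 12^5. *)

Require Import Defs.
From Stdlib Require Import Arith ZArith Reals List Lia Lra.
From Coquelicot Require Import Coquelicot.
From mathcomp Require all_boot zify.
Open Scope R_scope.

(** * The least common multiple of 1, ..., N *)

Lemma divide_fold_lcm (l : list nat) (k : nat) :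
  In k l -> Nat.divide k (fold_right Nat.lcm 1%nat l).
Proof.
  induction l as [|a l IH]; simpl; [easy|intros [->|H]].
  - apply Nat.divide_lcm_l.
  - apply Nat.divide_trans with (1 := IH H), Nat.divide_lcm_r.
Qed.

Lemma divide_lcm_upto (N k : nat) :
  (1 <= k)%nat -> (k <= N)%nat -> Nat.divide k (lcm_upto N).
Proof. intros. apply divide_fold_lcm, in_seq; lia. Qed.

Lemma lcm_upto_least (N X : nat) :
  (forall k, (1 <= k)%nat -> (k <= N)%nat -> Nat.divide k X) ->
  Nat.divide (lcm_upto N) X.
Proof.
  intros H.
  enough (forall l, (forall k, In k l -> Nat.divide k X) ->
    Nat.divide (fold_right Nat.lcm 1%nat l) X) as E.
  { apply E; intros k Hk%in_seq; apply H; lia. }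
  induction l as [|a l IH]; simpl; intros Hl; [apply Nat.divide_1_l|].
  apply Nat.lcm_least; [apply Hl|apply IH]; auto.
Qed.

Lemma lcm_upto_pos (N : nat) : (0 < lcm_upto N)%nat.
Proof.
  assert (H : Nat.divide (lcm_upto N) (fact N)).
  { apply lcm_upto_least; intros k H1; induction N as [|N IH]; intros HN; [lia|].
    change (fact (S N)) with (S N * fact N)%nat.
    destruct (Nat.eq_dec k (S N)) as [->|]; [apply Nat.divide_factor_l|].
    apply Nat.divide_mul_r, IH; lia. }
  destruct H as [q Hq]; pose proof (lt_O_fact N); nia.
Qed.

(** * Chebyshev's method for the least common multiple *)

Module ChebyshevBound.
Import all_boot zify.
Local Open Scope nat_scope.

(** Legendre's formula over a range common to several factorials, so that their sums compare
    termwise. The added terms vanish because [p ^ i > a]. *)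
Lemma logn_fact_widen p a N : prime p -> a <= N ->
  logn p a`! = \sum_(1 <= i < N.+1) a %/ p ^ i.
Proof.
move=> pP aN; rewrite logn_fact // [RHS](@big_cat_nat _ _ _ a.+1) //=.
rewrite [X in _ = _ + X]big_nat [X in _ = _ + X]big1 ?addn0 // => i /andP[ai _].
by rewrite divn_small // (leq_trans ai) // ltnW // ltn_expl // prime_gt1.
Qed.

(** Spreads an exponent over the range of Legendre's formula. *)
Lemma sum_leq_indicator e N : e <= N -> \sum_(1 <= i < N.+1) (i <= e) = e.
Proof.
elim: N e => [|N IH] e; first by rewrite leqn0 => /eqP->; rewrite big_geq.
rewrite big_nat_recr //= leq_eqVlt => /orP[/eqP->|eN].
  rewrite leqnn -[in RHS]addn1 -[X in _ = X + _](IH N) //; congr (_ + _).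
  by rewrite !big_nat; apply: eq_bigr => i /andP[_ iN]; lia.
by rewrite IH // leqNgt eN addn0.
Qed.

(* floor x - floor(x/2) - floor(x/3) - floor(x/6) is nonnegative, and positive
   for 1 <= x < 6, so each prime power in [N/6, N] contributes to the
   quotient of factorials. *)
Lemma dvdn_lcm_step (k N D Q : nat) :
  0 < k <= N -> 0 < D -> 0 < Q ->
  (forall j, 0 < j <= N %/ 6 -> j %| D) ->
  Q * ((N %/ 2)`! * (N %/ 3)`! * (N %/ 6)`!) = N`! ->
  k %| D * Q.
Proof.
move=> /andP[k0 kN] D0 Q0 HD HQ.
apply/dvdn_partP => // p; rewrite mem_primes => /and3P[pP _ _].
rewrite p_part pfactor_dvdn ?muln_gt0 ?D0 // lognM //.
(* [p ^ s] is the largest power of [p] up to [N %/ 6], or 1 if that quotient is 0. *)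
set e := logn p k; set s := trunc_log p (N %/ 6).
have p1 := prime_gt1 pP.
have eN : p ^ e <= N by rewrite (leq_trans _ kN) // dvdn_leq // pfactor_dvdnn.
have e_le : e <= N by apply: ltnW; rewrite (leq_trans _ eN) // ltn_expl.
have sD : s <= logn p D.
  rewrite -pfactor_dvdn //; case: (posnP (N %/ 6)) => [N0|N0].
    by rewrite /s N0 trunc_log0 expn0 dvd1n.
  by apply: HD; rewrite expn_gt0 (ltnW p1) /= trunc_logP.
have s_le : s <= N.
  rewrite /s (leq_trans (leq_trunc_log p (leq_div N 6))) //.
  case: (posnP N) => [->|N0]; first by rewrite trunc_log0.
  by apply: ltnW; rewrite (leq_trans _ (trunc_logP p1 N0)) // ltn_expl.
have := congr1 (logn p) HQ.
rewrite !lognM ?muln_gt0 ?fact_gt0 // !(@logn_fact_widen p _ N) ?leq_div //.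
set A := bigop _ _ _; set B := bigop _ _ _; set C := bigop _ _ _.
set T := bigop _ _ _ => HT.
suff: e + (A + B + C) <= s + T by lia.
rewrite -[X in X + _ <= _](sum_leq_indicator _ _ e_le).
rewrite -[X in _ <= X + _](sum_leq_indicator _ _ s_le) /A /B /C /T -!big_split /=.
rewrite !big_nat; apply: leq_sum => i /andP[i1 iN].
(* Swapping divisions makes each term a function of x = [N %/ p ^ i]. For i <= s nonnegativity
   suffices; for s < i <= e one has 1 <= x < 6. *)
rewrite !(divnAC _ _ (p ^ i)).
case: (leqP i s) => [_|si]; first by lia.
have : N %/ p ^ i < 6.
  rewrite ltn_divLR ?expn_gt0 ?(ltnW p1) // mulnC.
  rewrite -ltn_divLR //.
  by rewrite (leq_trans (trunc_log_ltn (N %/ 6) p1)) // leq_pexp2l // ltnW.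
case: (leqP i e) => [ie|_]; last by lia.
have : 0 < N %/ p ^ i.
  by rewrite divn_gt0 ?expn_gt0 ?(ltnW p1) // (leq_trans _ eN) // leq_pexp2l // ltnW.
by lia.
Qed.

Lemma bin_term_le x y n i : i <= n -> 'C(n, i) * (x ^ (n - i) * y ^ i) <= (x + y) ^ n.
Proof.
move=> iN; have iN' : i < n.+1 by [].
by rewrite expnDn (bigD1 (Ordinal iN')) //= leq_addr.
Qed.

(* A term of (2 + 3)^(a + b) times a term of (5 + 1)^(a + b + c). *)
Lemma trinomial_le a b c :
  'C(a + b + c, c) * 'C(a + b, a) <= 2 ^ a * 3 ^ b * 6 ^ c.
Proof.
(* The weights 3 : 2 : 1 of a, b, c follow the proportions of N/2, N/3, N/6. The factor 5^(a+b)
   links the two estimates. *)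
have H1 := bin_term_le 5 1 _ _ (leq_addl (a + b) c).
have H2 := bin_term_le 2 3 _ _ (leq_addr b a).
rewrite addnK exp1n muln1 in H1; rewrite addKn in H2.
have E : (5 + 1) ^ (a + b + c) = (2 ^ b * 3 ^ a) * (2 ^ a * 3 ^ b * 6 ^ c).
  have e6 x : 6 ^ x = 2 ^ x * 3 ^ x by rewrite -expnMn.
  rewrite -[5 + 1]/6 !expnD !e6; lia.
rewrite -(@leq_pmul2l (2 ^ b * 3 ^ a)) ?muln_gt0 ?expn_gt0 // -E.
apply: leq_trans H1.
rewrite (_ : _ * _ = 'C(a + b + c, c) * ('C(a + b, a) * (2 ^ b * 3 ^ a))); last by lia.
by rewrite leq_mul2l H2 orbT.
Qed.

(** Q is the multinomial coefficient of the three floors times at most two further factors, since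
    the floors add up to at least N - 2. The sixth power clears the exponents 1/2, 1/3, 1/6 of 2, 3,
    6, and 2^3 3^2 6 = 432. *)
Lemma factorial_quotient N : { Q : nat |
  Q * ((N %/ 2)`! * (N %/ 3)`! * (N %/ 6)`!) = N`! &
  Q ^ 6 <= N.+1 ^ 12 * 432 ^ N }.
Proof.
set a := N %/ 2; set b := N %/ 3; set c := N %/ 6.
have sN : a + b + c <= N by rewrite /a /b /c; lia.
have r2 : N - (a + b + c) <= 2 by rewrite /a /b /c; lia.
exists (N ^_ (N - (a + b + c)) * ('C(a + b + c, c) * 'C(a + b, a))).
  have := ffact_fact (leq_subr (a + b + c) N); rewrite subKn // => <-.
  have := bin_fact (leq_addl (a + b) c); rewrite addnK => <-.
  have := bin_fact (leq_addr b a); rewrite addKn => <-.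
  lia.
have F : N ^_ (N - (a + b + c)) <= N.+1 ^ 2.
  move: (N - _) r2 => [|[|[|//]]] _; rewrite ?ffactn0 ?ffactn1 ?ffactnSr ?ffactn0 -mulnn; nia.
have T := trinomial_le a b c.
apply: (@leq_trans ((N.+1 ^ 2 * (2 ^ a * 3 ^ b * 6 ^ c)) ^ 6)).
  by rewrite leq_exp2r // leq_mul.
rewrite expnMn -expnM leq_mul2l; apply/orP; right.
rewrite !expnMn -!expnM.
have -> : 432 ^ N = 2 ^ (3 * N) * 3 ^ (2 * N) * 6 ^ N by rewrite !expnM -!expnMn.
by apply: leq_mul; [apply: leq_mul|]; rewrite leq_pexp2l // /a /b /c; lia.
Qed.


Lemma dvdn_divide k n : reflect (Nat.divide k n) (k %| n).
Proof. by apply: (iffP dvdnP) => -[q ->]; exists q. Qed.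

Lemma leq_expn2r m n k : m <= n -> m ^ k <= n ^ k.
Proof. by case: k => // k mn; rewrite leq_exp2r. Qed.

(* The exponents keep the induction free of roots: the step bounds sixth powers,
   and N + N/6 + N/36 + ... <= 6N/5. *)
Lemma lcm_upto_exp_le e N : N < 6 ^ e ->
  lcm_upto N ^ 5 <= N.+1 ^ (10 * e) * 432 ^ N.
Proof.
elim: e N => [|e IH] N; first by rewrite expn0 ltnS leqn0 => /eqP->.
move=> N6; have [Q HQ Q6] := factorial_quotient N.
have {}IH : lcm_upto (N %/ 6) ^ 5 <= N.+1 ^ (10 * e) * 432 ^ (N %/ 6).
  apply: leq_trans (IH _ _) _; first by rewrite ltn_divLR // mulnC -expnS.
  by rewrite leq_mul2r leq_expn2r ?orbT // ltnS leq_div.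
have d0 : 0 < lcm_upto (N %/ 6) by apply/ltP/lcm_upto_pos.
have Q0 : 0 < Q by move: (fact_gt0 N); rewrite -HQ muln_gt0 => /andP[].
have dvd : lcm_upto N %| lcm_upto (N %/ 6) * Q.
  apply/dvdn_divide/lcm_upto_least => k k1 kN; apply/dvdn_divide.
  apply: (@dvdn_lcm_step k N) => //; first by apply/andP; split; apply/leP.
  by move=> j /andP[/leP j1 /leP jN]; apply/dvdn_divide/divide_lcm_upto.
have le := dvdn_leq _ dvd; rewrite muln_gt0 d0 Q0 in le.
rewrite -(@leq_exp2r _ _ 6) //.
apply: (@leq_trans ((lcm_upto (N %/ 6) ^ 5) ^ 6 * (Q ^ 6) ^ 5)).
  by rewrite -!expnM -expnMn leq_exp2r ?le.
apply: (@leq_trans ((N.+1 ^ (10 * e) * 432 ^ (N %/ 6)) ^ 6 *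
                    (N.+1 ^ 12 * 432 ^ N) ^ 5)).
  by apply: leq_mul; rewrite leq_exp2r.
(* The exponents agree: 60e + 60 = 60(e + 1), and 6 floor(N/6) + 5N <= 6N. *)
rewrite !expnMn -!expnM mulnACA -!expnD.
by apply: leq_mul; rewrite leq_pexp2l //; lia.
Qed.

Lemma expn_pow m n : expn m n = Nat.pow m n.
Proof. by elim: n => //= n <-; rewrite expnS. Qed.

(** Restated in the [Nat] arithmetic used outside this module. *)
Lemma lcm_upto_pow_le e N : Peano.lt N (Nat.pow 6 e) ->
  Peano.le (Nat.pow (lcm_upto N) 5)
    (Nat.mul (Nat.pow N.+1 (Nat.mul 10 e)) (Nat.pow 432 N)).
Proof.
rewrite -!expn_pow => /ltP H; apply/leP; exact: lcm_upto_exp_le.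
Qed.

End ChebyshevBound.

(** * Harmonic and alternating harmonic sums *)

Definition harmonic (n : nat) : R := sum_n_m (fun k => / INR k) 1 n.

Definition alt_harmonic (n : nat) : R :=
  sum_n_m (fun l => (-1) ^ (l - 1) / INR l) 1 n.

Lemma harmonic_S (n : nat) : harmonic (S n) = harmonic n + / INR (S n).
Proof. unfold harmonic; rewrite sum_n_Sm by lia; reflexivity. Qed.

Lemma alt_harmonic_S (n : nat) :
  alt_harmonic (S n) = alt_harmonic n + (-1) ^ n / INR (S n).
Proof.
  unfold alt_harmonic; rewrite sum_n_Sm by lia.
  replace (S n - 1)%nat with n by lia; reflexivity.
Qed.

Lemma harmonic_0 : harmonic 0 = 0.
Proof. unfold harmonic; rewrite sum_n_m_zero by lia; reflexivity. Qed.

Lemma alt_harmonic_0 : alt_harmonic 0 = 0.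
Proof. unfold alt_harmonic; rewrite sum_n_m_zero by lia; reflexivity. Qed.

Lemma sum_n_S (f : nat -> R) (n : nat) :
  sum_n f (S n) = sum_n f n + f (S n) :> R.
Proof. exact (sum_Sn f n). Qed.

Lemma pow_m1_double (n : nat) : (-1) ^ (2 * n) = 1.
Proof. rewrite pow_mult; replace ((-1) ^ 2) with 1 by ring; apply pow1. Qed.

Lemma INR_S_pos (n : nat) : 0 < INR (S n).
Proof. apply lt_0_INR; lia. Qed.

(** Catalan's identity: the even-indexed terms are subtracted twice. It gives both the limit ln 2
    and the telescoping of Vacca's series. *)
Lemma alt_harmonic_double (K : nat) :
  alt_harmonic (2 * K) = harmonic (2 * K) - harmonic K.
Proof.
  induction K as [|K IH].
  - simpl; rewrite alt_harmonic_0, harmonic_0; ring.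
  - replace (2 * S K)%nat with (S (S (2 * K))) by lia.
    rewrite !alt_harmonic_S, !harmonic_S, IH.
    replace ((-1) ^ S (2 * K)) with (-1) by (rewrite <- tech_pow_Rmult, pow_m1_double; ring).
    rewrite pow_m1_double.
    replace (INR (S (S (2 * K)))) with (2 * INR (S K)) by (rewrite !S_INR, mult_INR; simpl; ring).
    pose proof (INR_S_pos K); pose proof (INR_S_pos (2 * K)); field; lra.
Qed.

Lemma ln_le_sub_1 (x : R) : 0 < x -> ln x <= x - 1.
Proof.
  intros Hx; pose proof (exp_ineq1_le (ln x)) as H; rewrite exp_ln in H; lra.
Qed.

(** Both bounds are [ln x <= x - 1], taken at the ratio and at its inverse. *)
Lemma ln_ratio_bounds (n : nat) :
  / INR (S (S n)) <= ln (INR (S (S n))) - ln (INR (S n)) <= / INR (S n).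
Proof.
  pose proof (INR_S_pos n) as H1; pose proof (INR_S_pos (S n)) as H2.
  assert (E : INR (S (S n)) = INR (S n) + 1) by apply S_INR.
  rewrite <- ln_div by assumption; split.
  - replace (INR (S (S n)) / INR (S n)) with (/ (INR (S n) / INR (S (S n)))) by (field; lra).
    rewrite ln_Rinv by (apply Rdiv_lt_0_compat; assumption).
    pose proof (ln_le_sub_1 (INR (S n) / INR (S (S n)))
      ltac:(apply Rdiv_lt_0_compat; assumption)) as H.
    replace (INR (S n) / INR (S (S n)) - 1) with (- / INR (S (S n))) in H; [lra|].
    rewrite E; field; lra.
  - pose proof (ln_le_sub_1 (INR (S (S n)) / INR (S n))
      ltac:(apply Rdiv_lt_0_compat; assumption)) as H.
    replace (INR (S (S n)) / INR (S n) - 1) with (/ INR (S n)) in H; [lra|].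
    rewrite E; field; lra.
Qed.

(** [Lim_seq] is total, so convergence needs proof: shifted by one, away from [ln 0], the sequence
    decreases and is bounded below by 0. *)
Lemma is_lim_seq_euler_gamma :
  is_lim_seq (fun n => harmonic n - ln (INR n)) euler_gamma.
Proof.
  assert (Hlow : forall n, ln (INR (S n)) <= harmonic n).
  { induction n as [|n IH].
    - rewrite harmonic_0; simpl; rewrite ln_1; lra.
    - rewrite harmonic_S; pose proof (ln_ratio_bounds n); lra. }
  assert (Hex : ex_finite_lim_seq (fun n => harmonic n - ln (INR n))).
  { enough (ex_finite_lim_seq (fun n => harmonic (S n) - ln (INR (S n)))) as [l Hl]
      by (exists l; apply is_lim_seq_incr_1, Hl).
    apply ex_finite_lim_seq_decr with 0; intros n.
    - rewrite (harmonic_S (S n)); pose proof (ln_ratio_bounds n); lra.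
    - rewrite harmonic_S; pose proof (Hlow n).
      pose proof (Rinv_0_lt_compat _ (INR_S_pos n)); lra. }
  exact (Lim_seq_correct' _ Hex).
Qed.

(** By Catalan's identity the even partial sums are a difference of two sequences tending to gamma,
    plus ln 2. An odd one differs from its even predecessor by 1/n, so squeezing finishes. *)
Lemma is_lim_seq_alt_harmonic : is_lim_seq alt_harmonic (ln 2).
Proof.
  assert (Hsub : forall phi, filterlim phi eventually eventually ->
    is_lim_seq (fun n => harmonic (phi n) - ln (INR (phi n))) euler_gamma).
  { intros phi Hphi.
    exact (is_lim_seq_subseq _ _ phi Hphi is_lim_seq_euler_gamma). }
  assert (Hdiv : filterlim (fun n => n / 2)%nat eventually eventually).
  { intros P [N HN]; exists (2 * N)%nat; intros n Hn; apply HN.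
    apply Nat.div_le_lower_bound; lia. }
  assert (Hdiv2 : filterlim (fun n => 2 * (n / 2))%nat eventually eventually).
  { intros P [N HN]; exists (2 * N + 2)%nat; intros n Hn; apply HN.
    pose proof (Nat.div_mod_eq n 2); pose proof (Nat.mod_upper_bound n 2); lia. }
  assert (Heven : is_lim_seq (fun n => alt_harmonic (2 * (n / 2))) (ln 2)).
  { pose proof (is_lim_seq_plus' _ _ _ _
      (is_lim_seq_minus' _ _ _ _ (Hsub _ Hdiv2) (Hsub _ Hdiv))
      (is_lim_seq_const (ln 2))) as H.
    replace (euler_gamma - euler_gamma + ln 2) with (ln 2) in H by ring.
    apply is_lim_seq_ext_loc with (2 := H).
    exists 2%nat; intros n Hn.
    assert (0 < n / 2)%nat by (apply Nat.div_str_pos; lia).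
    rewrite alt_harmonic_double, (mult_INR 2), ln_mult.
    - simpl INR; replace (1 + 1) with 2 by ring; ring.
    - simpl; lra.
    - apply lt_0_INR; assumption. }
  assert (Hinv : is_lim_seq (fun n => / INR n) 0).
  { apply is_lim_seq_incr_1.
    apply (is_lim_seq_inv (fun n => INR (S n)) p_infty).
    - apply is_lim_seq_incr_1 with (u := INR), is_lim_seq_INR.
    - easy. }
  apply is_lim_seq_le_le_loc with
    (u := fun n => alt_harmonic (2 * (n / 2)) - / INR n)
    (w := fun n => alt_harmonic (2 * (n / 2)) + / INR n).
  - exists 1%nat; intros n Hn.
    assert (0 < / INR n) by (apply Rinv_0_lt_compat, lt_0_INR; lia).
    pose proof (Nat.div_mod_eq n 2) as E.
    pose proof (Nat.mod_upper_bound n 2).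
    destruct (Nat.eq_dec (n mod 2) 0) as [E0|E0].
    + replace (2 * (n / 2))%nat with n by lia; lra.
    + assert (En : n = S (2 * (n / 2))) by lia.
      assert (alt_harmonic n = alt_harmonic (2 * (n / 2)) + / INR n); [|lra].
      rewrite En at 1; rewrite alt_harmonic_S, pow_m1_double, <- En; lra.
  - replace (Finite (ln 2)) with (Finite (ln 2 - 0)) by (f_equal; ring).
    apply is_lim_seq_minus'; assumption.
  - replace (Finite (ln 2)) with (Finite (ln 2 + 0)) by (f_equal; ring).
    apply is_lim_seq_plus'; assumption.
Qed.

(** The tail of the series for ln 2 after [x] terms, with its sign normalised so that the first term
    is positive. *)
Lemma is_series_alt_inv (x : nat) :
  is_series (fun t => (-1) ^ t / (INR (S x) + INR t))
            ((-1) ^ S x * (alt_harmonic x - ln 2)).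
Proof.
  assert (H1 : (-1) ^ S x * (-1) ^ S x = 1).
  { rewrite <- pow_add; replace (S x + S x)%nat with (2 * S x)%nat by lia.
    apply pow_m1_double. }
  assert (E : forall n, sum_n (fun t => (-1) ^ t / (INR (S x) + INR t)) n =
    (-1) ^ S x * (alt_harmonic x - alt_harmonic (S n + x)) :> R).
  { induction n as [|n IH].
    - rewrite sum_O, alt_harmonic_S.
      replace (INR 0) with 0 by reflexivity; rewrite Rplus_0_r.
      replace ((-1) ^ 0) with ((-1) ^ S x * (-1) ^ S x) by (rewrite H1; reflexivity).
      pose proof (INR_S_pos x); rewrite <- tech_pow_Rmult; field; lra.
    - rewrite sum_n_S, IH; replace (S (S n) + x)%nat with (S (S n + x)) by lia.
      rewrite (alt_harmonic_S (S n + x)), <- plus_INR.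
      replace (S x + S n)%nat with (S (S n + x)) by lia.
      replace ((-1) ^ S n) with ((-1) ^ S x * (-1) ^ S x * (-1) ^ S n) by (rewrite H1; ring).
      rewrite (pow_add (-1) (S n) x), <- !tech_pow_Rmult.
      pose proof (INR_S_pos (S n + x)); field; lra. }
  change (is_lim_seq (sum_n (fun t => (-1) ^ t / (INR (S x) + INR t)))
    ((-1) ^ S x * (alt_harmonic x - ln 2))).
  apply is_lim_seq_ext with (1 := fun n => eq_sym (E n)).
  apply is_lim_seq_scal_l with (lu := Finite (alt_harmonic x - ln 2)).
  apply is_lim_seq_minus'; [apply is_lim_seq_const|].
  apply is_lim_seq_subseq with (2 := is_lim_seq_alt_harmonic).
  intros P [N HN]; exists N; intros n Hn; apply HN; lia.
Qed.

(** * The alternating sums S *)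

(* The sum of C(m,j) g(j) over j <= m, by Pascal's rule. *)
Fixpoint binomial_sum (m : nat) (g : nat -> R) : R :=
  match m with
  | O => g O
  | S m' => binomial_sum m' g + binomial_sum m' (fun j => g (S j))
  end.

Lemma binomial_sum_ext (m : nat) (f g : nat -> R) :
  (forall j, (j <= m)%nat -> f j = g j) -> binomial_sum m f = binomial_sum m g.
Proof.
  revert f g; induction m as [|m IH]; simpl; intros f g H; [apply H; lia|].
  f_equal; apply IH; intros; apply H; lia.
Qed.

Lemma binomial_sum_plus (m : nat) (f g : nat -> R) :
  binomial_sum m (fun j => f j + g j) = binomial_sum m f + binomial_sum m g.
Proof.
  revert f g; induction m as [|m IH]; simpl; intros f g; [reflexivity|].
  rewrite !IH; ring.
Qed.

Lemma binomial_sum_scal (m : nat) (c : R) (g : nat -> R) :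
  binomial_sum m (fun j => c * g j) = c * binomial_sum m g.
Proof.
  revert g; induction m as [|m IH]; simpl; intros g; [reflexivity|].
  rewrite !IH; ring.
Qed.

Lemma binomial_sum_const (m : nat) (c : R) : binomial_sum m (fun _ => c) = 2 ^ m * c.
Proof. induction m as [|m IH]; simpl; [|rewrite IH]; ring. Qed.

(** The recursion only adds values of [g]. *)
Lemma binomial_sum_integer (m : nat) (g : nat -> R) :
  (forall j, exists z, g j = IZR z) -> exists z, binomial_sum m g = IZR z.
Proof.
  revert g; induction m as [|m IH]; simpl; intros g H; [apply H|].
  destruct (IH g H) as [z1 E1], (IH _ (fun j => H (S j))) as [z2 E2].
  exists (z1 + z2)%Z; rewrite E1, E2, plus_IZR; reflexivity.
Qed.

Lemma is_series_plus_R (f g : nat -> R) (a b : R) :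
  is_series f a -> is_series g b -> is_series (fun i => f i + g i) (a + b).
Proof. exact (is_series_plus f g a b). Qed.

Lemma is_series_scal_R (c : R) (f : nat -> R) (a : R) :
  is_series f a -> is_series (fun i => c * f i) (c * a).
Proof. exact (is_series_scal_l c f a). Qed.

Lemma is_series_ext_R (f g : nat -> R) (a : R) :
  (forall i, f i = g i) -> is_series f a -> is_series g a.
Proof. exact (is_series_ext f g a). Qed.

Lemma is_series_binomial_sum (m : nat) (h : nat -> nat -> R) (l : nat -> R) :
  (forall j, (j <= m)%nat -> is_series (fun i => h i j) (l j)) ->
  is_series (fun i => binomial_sum m (h i)) (binomial_sum m l).
Proof.
  revert h l; induction m as [|m IH]; simpl; intros h l H; [apply H; lia|].
  apply is_series_plus_R.
  - apply IH; intros; apply H; lia.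
  - apply (IH (fun i j => h i (S j)) (fun j => l (S j))); intros; apply H; lia.
Qed.

Lemma binomial_sumE (m : nat) (g : nat -> R) :
  binomial_sum m g = sum_f_R0 (fun j => Binomial.C m j * g j) m.
Proof.
  revert g; induction m as [|m IH]; intros g; simpl binomial_sum.
  { unfold Binomial.C; simpl; field. }
  rewrite !IH.
  assert (C0 : forall k, Binomial.C k 0 = 1).
  { intros k; unfold Binomial.C; rewrite Nat.sub_0_r; simpl fact; simpl INR.
    field; apply INR_fact_neq_0. }
  assert (Cn : forall k, Binomial.C k k = 1).
  { intros k; unfold Binomial.C; rewrite Nat.sub_diag; simpl fact; simpl INR.
    field; apply INR_fact_neq_0. }
  destruct m as [|m].
  { simpl; rewrite !C0, Cn; ring. }
  (* The end terms have coefficient 1 and are split off; Pascal's rule covers the others. *)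
  rewrite (decomp_sum (fun j => Binomial.C (S m) j * g j)) by lia.
  rewrite (decomp_sum _ (S (S m))) by lia; simpl pred.
  rewrite (tech5 (fun j => Binomial.C (S m) j * g (S j))).
  rewrite (tech5 (fun i => Binomial.C (S (S m)) (S i) * g (S i))).
  rewrite !C0, !Cn.
  rewrite (sum_eq (fun i => Binomial.C (S (S m)) (S i) * g (S i))
    (fun i => Binomial.C (S m) (S i) * g (S i) + Binomial.C (S m) i * g (S i))).
  - rewrite sum_plus; ring.
  - intros i Hi; rewrite <- pascal by lia; ring.
Qed.

(** * The rational functions R_m *)

Lemma prod_f_R0_pos (m : nat) (t : R) :
  0 < t -> 0 < prod_f_R0 (fun i => t + INR i) m.
Proof.
  intros Ht; induction m as [|m IH]; [simpl; lra|cbn [prod_f_R0]].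
  apply Rmult_lt_0_compat; [apply IH|]; pose proof (pos_INR (S m)); lra.
Qed.

Lemma R_frac_pos (m : nat) (t : R) : 0 < t -> 0 < R_frac m t.
Proof.
  intros Ht; apply Rdiv_lt_0_compat; [apply lt_0_INR, lt_O_fact|].
  apply prod_f_R0_pos, Ht.
Qed.

Lemma prod_f_R0_shift (m : nat) (t : R) :
  t * prod_f_R0 (fun i => t + 1 + INR i) m = prod_f_R0 (fun i => t + INR i) (S m).
Proof.
  induction m as [|m IH]; [simpl; ring|].
  cbn [prod_f_R0] in *; rewrite <- Rmult_assoc, IH, (S_INR (S m)); ring.
Qed.

(** The recursive form of the partial fractions R_m(t) = sum of (-1)^j C(m,j)/(t+j), parallel to the
    recursion of [binomial_sum]. *)
Lemma R_frac_S (m : nat) (t : R) : 0 < t ->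
  R_frac (S m) t = R_frac m t - R_frac m (t + 1).
Proof.
  intros Ht; unfold R_frac.
  pose proof (prod_f_R0_shift m t) as H.
  pose proof (prod_f_R0_pos m t Ht).
  pose proof (prod_f_R0_pos m (t + 1) ltac:(lra)).
  assert (E : prod_f_R0 (fun i => t + 1 + INR i) m =
    prod_f_R0 (fun i => t + INR i) m * (t + INR (S m)) / t).
  { apply Rmult_eq_reg_l with t; [rewrite H; simpl; field|]; lra. }
  rewrite E; cbn [prod_f_R0]; rewrite fact_simpl, mult_INR.
  pose proof (pos_INR (S m)); field; lra.
Qed.

(** Induction on [m] through [R_frac_S]: the shift t -> t + 1 flips the sign [(-1) ^ S x], which
    cancels the minus of the difference and leaves the sum in Pascal's rule. *)
Lemma is_series_alt_R_frac (m x : nat) :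
  is_series (fun t => (-1) ^ t * R_frac m (INR (S x) + INR t))
    ((-1) ^ S x * binomial_sum m (fun j => alt_harmonic (x + j) - ln 2)).
Proof.
  revert x; induction m as [|m IH]; intros x.
  - simpl binomial_sum; rewrite Nat.add_0_r.
    apply is_series_ext_R with (2 := is_series_alt_inv x).
    intros t; unfold R_frac, Rdiv; cbn -[INR]; simpl (INR 0); simpl (INR 1).
    rewrite Rplus_0_r, Rmult_1_l; reflexivity.
  - pose proof (is_series_plus_R _ _ _ _ (IH x)
      (is_series_scal_R (-1) _ _ (IH (S x)))) as H.
    rewrite (binomial_sum_ext m (fun j => alt_harmonic (S x + j) - ln 2)
      (fun j => alt_harmonic (x + S j) - ln 2)) in H
      by (intros; rewrite Nat.add_succ_comm; reflexivity).
    simpl binomial_sum.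
    match goal with |- is_series _ ?b =>
      match type of H with is_series _ ?a => replace b with a end end.
    + apply is_series_ext_R with (2 := H); intros t.
      pose proof (INR_S_pos x); pose proof (pos_INR t).
      rewrite R_frac_S by lra; rewrite (S_INR (S x)).
      replace (INR (S x) + 1 + INR t) with (INR (S x) + INR t + 1) by ring.
      simpl; ring.
    + rewrite <- (tech_pow_Rmult (-1) (S x)); ring.
Qed.

Lemma pow2_S_pred (nu : nat) : exists x, (2 ^ nu = S x)%nat.
Proof.
  exists (pred (2 ^ nu)); pose proof (Nat.pow_nonzero 2 nu); lia.
Qed.

Lemma S_sum_spec (nu m : nat) : (1 <= nu)%nat ->
  is_series (fun t => (-1) ^ t * R_frac m (2 ^ nu + INR t)) (S_sum nu m) /\
  S_sum nu m = binomial_sum m (fun j => alt_harmonic (2 ^ nu - 1 + j) - ln 2).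
Proof.
  intros Hnu; destruct (pow2_S_pred nu) as [x Hx].
  pose proof (is_series_alt_R_frac m x) as H; rewrite <- Hx in H.
  (* Here [1 <= nu] matters: 2^nu is even. *)
  replace ((-1) ^ (2 ^ nu)) with 1 in H.
  2:{ destruct nu as [|nu]; [lia|]; rewrite Nat.pow_succ_r', pow_m1_double; easy. }
  rewrite Rmult_1_l, pow_INR in H; change (INR 2) with 2 in H.
  replace x with (2 ^ nu - 1)%nat in H by lia.
  pose proof (is_series_unique _ _ H) as E; unfold S_sum; rewrite E; split; auto.
Qed.

(** Leibniz: peeling off the first term leaves [u O] minus an alternating sum that lies between 0
    and [u 1]. *)
Lemma alternating_sum_bounds (u : nat -> R) (N : nat) :
  (forall t, 0 <= u (S t) <= u t) ->
  0 <= sum_n (fun t => (-1) ^ t * u t) N <= u O.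
Proof.
  intros Hu; revert u Hu; induction N as [|N IH]; intros u Hu.
  - rewrite sum_O; simpl; specialize (Hu O); lra.
  - specialize (IH (fun t => u (S t)) (fun t => Hu (S t))).
    assert (E : sum_n (fun t => (-1) ^ t * u t) (S N) =
      u O - sum_n (fun t => (-1) ^ t * u (S t)) N :> R).
    { clear; induction N as [|N IH]; rewrite sum_n_S.
      - rewrite !sum_O; simpl; ring.
      - rewrite IH, sum_n_S; simpl; ring. }
    rewrite E; specialize (Hu O); lra.
Qed.

(** The decrease is R_{m+1}(t) > 0. *)
Lemma R_frac_decr (m : nat) (t : R) : 0 < t -> R_frac m (t + 1) <= R_frac m t.
Proof.
  intros Ht; pose proof (R_frac_pos (S m) t Ht) as H.
  rewrite R_frac_S in H by assumption; lra.
Qed.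

Lemma S_sum_bounds (nu m : nat) : (1 <= nu)%nat ->
  0 <= S_sum nu m <= R_frac m (2 ^ nu).
Proof.
  intros Hnu; destruct (S_sum_spec nu m Hnu) as [H _].
  assert (B : forall N, 0 <=
    sum_n (fun t => (-1) ^ t * R_frac m (2 ^ nu + INR t)) N <= R_frac m (2 ^ nu)).
  { intros N; pose proof (alternating_sum_bounds
      (fun t => R_frac m (2 ^ nu + INR t)) N) as A.
    cbv beta in A; change (INR 0) with 0 in A; rewrite Rplus_0_r in A; apply A; intros t.
    assert (0 < 2 ^ nu) by (apply pow_lt; lra).
    pose proof (pos_INR t); rewrite S_INR, <- Rplus_assoc; split.
    - apply Rlt_le, R_frac_pos; lra.
    - apply R_frac_decr; lra. }
  split.
  - apply (is_lim_seq_le (fun _ => 0) _ 0 (S_sum nu m)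
      (fun N => proj1 (B N)) (is_lim_seq_const 0) H).
  - apply (is_lim_seq_le _ (fun _ => R_frac m (2 ^ nu)) (S_sum nu m)
      (R_frac m (2 ^ nu)) (fun N => proj2 (B N)) H (is_lim_seq_const _)).
Qed.

(** * The q-logarithm and Vacca's series *)

Definition q_ln_term (z : R) (i : nat) : R := (-1) ^ i * z ^ S i / (2 ^ S i - 1).

Lemma q_ln_2 (z : R) : q_ln 2 (1 + z) = Series (q_ln_term z).
Proof.
  apply Series_ext; intros i; unfold q_ln_term.
  replace (1 + z - 1) with z by ring; reflexivity.
Qed.

Lemma pow2_ge_1 (i : nat) : 1 <= 2 ^ i.
Proof. apply pow_R1_Rle; lra. Qed.

(** From 2^(i+1) - 1 >= 2^i: a geometric majorant, summable for all z < 2. *)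
Lemma q_ln_term_bound (z : R) (i : nat) : 0 <= z ->
  Rabs (q_ln_term z i) <= z * (z / 2) ^ i.
Proof.
  intros Hz; unfold q_ln_term, Rdiv.
  pose proof (pow2_ge_1 i) as H2; pose proof (pow_le z i Hz) as Hzi.
  assert (H : 2 ^ i <= 2 ^ S i - 1) by (simpl; lra).
  rewrite !Rabs_mult, pow_1_abs, Rmult_1_l, Rpow_mult_distr, pow_inv.
  rewrite (Rabs_pos_eq (z ^ S i)) by (apply pow_le, Hz).
  rewrite Rabs_inv, (Rabs_pos_eq (2 ^ S i - 1)) by lra.
  rewrite <- Rmult_assoc; apply Rmult_le_compat_l.
  - apply (pow_le z (S i) Hz).
  - apply Rinv_le_contravar; lra.
Qed.

Lemma is_series_q_ln_bound (z : R) : 0 <= z < 2 ->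
  is_series (fun i => z * (z / 2) ^ i) (z * / (1 - z / 2)).
Proof.
  intros Hz; apply is_series_scal_R, is_series_geom, Rabs_def1; lra.
Qed.

Lemma is_series_q_ln (z : R) : 0 <= z < 2 ->
  is_series (q_ln_term z) (q_ln 2 (1 + z)).
Proof.
  intros Hz; rewrite q_ln_2; apply Series_correct.
  apply (ex_series_le (q_ln_term z) (fun i => z * (z / 2) ^ i)).
  - intros i; apply q_ln_term_bound, Hz.
  - eexists; apply is_series_q_ln_bound, Hz.
Qed.

(** Halving z multiplies the z^mu term by 2^(-mu), so in the difference the denominator 2^mu - 1
    cancels and a geometric series in -z/2 remains. *)
Lemma q_ln_half (z : R) : 0 <= z < 2 ->
  q_ln 2 (1 + z) - q_ln 2 (1 + z / 2) = z / (2 + z).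
Proof.
  intros Hz.
  pose proof (is_series_plus_R _ _ _ _ (is_series_q_ln z Hz)
    (is_series_scal_R (-1) _ _ (is_series_q_ln (z / 2) ltac:(lra)))) as H1.
  pose proof (is_series_scal_R (z / 2) _ _
    (is_series_geom (- (z / 2)) ltac:(apply Rabs_def1; lra))) as H2.
  apply is_series_unique in H1, H2.
  rewrite (Series_ext _ (fun i => z / 2 * (- (z / 2)) ^ i)) in H1.
  - rewrite H1 in H2; replace (z / (2 + z)) with (z / 2 * / (1 - - (z / 2))) by (field; lra); lra.
  - intros i; unfold q_ln_term; replace (- (z / 2)) with ((-1) * (z * / 2)) by field.
    unfold Rdiv; rewrite !Rpow_mult_distr, !pow_inv.
    pose proof (pow2_ge_1 i); simpl pow; field; simpl; lra.
Qed.

(** Makes the remainder vanish when the functional equation is iterated. *)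
Lemma q_ln_small (w : R) : 0 <= w <= 1 -> Rabs (q_ln 2 (1 + w)) <= 2 * w.
Proof.
  intros Hw; pose proof (is_series_q_ln_bound w ltac:(lra)) as HB.
  assert (Hex : ex_series (fun i => Rabs (q_ln_term w i))).
  { apply (ex_series_le (fun i => Rabs (q_ln_term w i)) (fun i => w * (w / 2) ^ i)).
    - intros i; apply Rle_trans with (2 := q_ln_term_bound w i (proj1 Hw)).
      apply Req_le, Rabs_pos_eq, Rabs_pos.
    - eexists; apply HB. }
  rewrite q_ln_2; apply Rle_trans with (1 := Series_Rabs _ Hex).
  apply Rle_trans with (Series (fun i => w * (w / 2) ^ i)).
  - apply Series_le; [|eexists; apply HB].
    intros i; split; [apply Rabs_pos|apply q_ln_term_bound, Hw].
  - rewrite (is_series_unique _ _ HB), (Rmult_comm 2); apply Rmult_le_compat_l; [lra|].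
    rewrite <- (Rinv_inv 2); apply Rinv_le_contravar; lra.
Qed.

Lemma is_lim_seq_pow_half (z : R) : is_lim_seq (fun n => z / 2 ^ n) 0.
Proof.
  replace (Finite 0) with (Finite (z * 0)) by (f_equal; ring).
  apply is_lim_seq_ext with (fun n => z * (/ 2) ^ n).
  - intros n; rewrite pow_inv; reflexivity.
  - apply is_lim_seq_scal_l with (lu := Finite 0), is_lim_seq_geom, Rabs_def1; lra.
Qed.

(* Summing the functional equation over z, z/2, z/4, ... avoids exchanging the
   two summations. *)
Lemma is_series_q_ln_dyadic (z : R) : 0 <= z < 2 ->
  is_series (fun i => z / (2 ^ S i + z)) (q_ln 2 (1 + z)).
Proof.
  intros Hz.
  assert (Hd : forall n, 0 <= z / 2 ^ n <= z).
  { intros n; pose proof (pow2_ge_1 n); split; [apply Rdiv_le_0_compat; lra|].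
    apply Rle_div_l; nra. }
  assert (E : forall n, sum_n (fun i => z / (2 ^ S i + z)) n =
    q_ln 2 (1 + z) - q_ln 2 (1 + z / 2 ^ S n) :> R).
  { assert (E1 : forall n, z / (2 ^ S n + z) =
      q_ln 2 (1 + z / 2 ^ n) - q_ln 2 (1 + z / 2 ^ S n)).
    { intros n; pose proof (pow2_ge_1 n); specialize (Hd n).
      replace (z / 2 ^ S n) with (z / 2 ^ n / 2) by (simpl; field; lra).
      rewrite q_ln_half by lra; simpl; field; lra. }
    induction n as [|n IH].
    - rewrite sum_O, E1; simpl (2 ^ 0); unfold Rdiv at 1; rewrite Rinv_1, Rmult_1_r; reflexivity.
    - rewrite sum_n_S, IH, E1; ring. }
  change (is_lim_seq (sum_n (fun i => z / (2 ^ S i + z))) (q_ln 2 (1 + z))).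
  apply is_lim_seq_ext with (1 := fun n => eq_sym (E n)).
  replace (q_ln 2 (1 + z)) with (q_ln 2 (1 + z) - 0) at 1 by ring.
  apply is_lim_seq_minus'; [apply is_lim_seq_const|].
  apply is_lim_seq_abs_0.
  (* The remainder sits at z/2^(n+1), which is at most 1 because z < 2. *)
  apply is_lim_seq_le_le with (u := fun _ => 0) (w := fun n => 2 * (z / 2 ^ S n)).
  - intros n; split; [apply Rabs_pos|apply q_ln_small].
    split; [apply Hd|]; specialize (Hd n); simpl; pose proof (pow2_ge_1 n).
    apply Rle_div_l; [lra|nra].
  - apply is_lim_seq_const.
  - replace (Finite 0) with (Finite (2 * 0)) by (f_equal; ring).
    apply is_lim_seq_scal_l with (lu := Finite 0).
    apply -> (is_lim_seq_incr_1 (fun n => z / 2 ^ n)); apply is_lim_seq_pow_half.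
Qed.

(** The dyadic series at z = k/2^n, divided by k; the upper bound on [k] is the condition z < 2. *)
Lemma is_series_inv_pow2_plus (n k : nat) : (1 <= k < 2 ^ (n + 1))%nat ->
  is_series (fun i => / (2 ^ (n + 1 + i) + INR k))
    (q_ln 2 (1 + INR k / 2 ^ n) / INR k).
Proof.
  intros Hk; assert (Hk0 : 0 < INR k) by (apply lt_0_INR; lia).
  pose proof (pow2_ge_1 n).
  assert (Hk1 : INR k < 2 * 2 ^ n).
  { replace (2 * 2 ^ n) with (INR (2 ^ (n + 1))); [apply lt_INR; lia|].
    rewrite pow_INR, Nat.add_1_r; reflexivity. }
  assert (Hz : 0 <= INR k / 2 ^ n < 2).
  { split; [apply Rdiv_le_0_compat; lra|apply Rlt_div_l; lra]. }
  replace (q_ln 2 (1 + INR k / 2 ^ n) / INR k) with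
    (/ INR k * q_ln 2 (1 + INR k / 2 ^ n)) by (field; lra).
  apply is_series_ext_R with
    (2 := is_series_scal_R (/ INR k) _ _ (is_series_q_ln_dyadic _ Hz)).
  intros i; replace (n + 1 + i)%nat with (n + S i)%nat by lia.
  rewrite pow_add; pose proof (pow2_ge_1 (S i)); field; nra.
Qed.

(** The counterpart for k = 0, where the formula with division by k makes no sense. *)
Lemma is_series_inv_pow2 (n : nat) :
  is_series (fun i => / 2 ^ (n + 1 + i)) (/ 2 ^ n).
Proof.
  pose proof (pow2_ge_1 n).
  replace (/ 2 ^ n) with (/ 2 ^ (n + 1) * / (1 - / 2)).
  2:{ rewrite pow_add; field; lra. }
  apply is_series_ext_R with (fun i => / 2 ^ (n + 1) * (/ 2) ^ i).
  - intros i; rewrite pow_inv, (pow_add 2 (n + 1)); symmetry; apply Rinv_mult.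
  - apply is_series_scal_R, is_series_geom, Rabs_def1; lra.
Qed.

(* Vacca's series: by alt_harmonic_double its partial sums telescope. *)
Lemma is_series_vacca (n : nat) :
  is_series (fun i => alt_harmonic (2 ^ (n + 1 + i) - 1) - ln 2)
    (euler_gamma - (harmonic (2 ^ n) - ln (2 ^ n) - / 2 ^ n)).
Proof.
  (* The alternating sum stops at 2^(k+1) - 1, one term short of Catalan's identity. The correction
     - 1/2^k absorbs this, as 1/2^k - 1/2^(k+1) = 1/2^(k+1). *)
  set (v := fun k => harmonic (2 ^ k) - ln (INR (2 ^ k)) - / 2 ^ k).
  assert (HI : forall k, INR (2 ^ k) = 2 ^ k) by (intros k; rewrite pow_INR; reflexivity).
  assert (E1 : forall k, alt_harmonic (2 ^ S k - 1) - ln 2 = v (S k) - v k).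
  { intros k; destruct (pow2_S_pred (S k)) as [x Hx].
    assert (Hodd : (-1) ^ x = -1).
    { assert ((-1) ^ S x = 1) by (rewrite <- Hx, Nat.pow_succ_r'; apply pow_m1_double).
      simpl in *; lra. }
    pose proof (alt_harmonic_S x) as A; rewrite <- Hx, Hodd in A.
    rewrite Nat.pow_succ_r', alt_harmonic_double, <- Nat.pow_succ_r' in A.
    replace (2 ^ S k - 1)%nat with x by lia; unfold v.
    rewrite !HI in *; pose proof (pow2_ge_1 k).
    rewrite <- (tech_pow_Rmult 2) in *; rewrite ln_mult by lra.
    replace (/ 2 ^ k) with (2 * / (2 * 2 ^ k)) by (field; lra); lra. }
  assert (E : forall N, sum_n (fun i => alt_harmonic (2 ^ (n + 1 + i) - 1) - ln 2) N =
    v (n + 1 + N)%nat - v n :> R).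
  { induction N as [|N IH].
    - rewrite sum_O, !Nat.add_0_r, Nat.add_1_r; apply E1.
    - rewrite sum_n_S, IH.
      replace (n + 1 + S N)%nat with (S (n + 1 + N)) by lia; rewrite E1; ring. }
  change (is_lim_seq (sum_n (fun i => alt_harmonic (2 ^ (n + 1 + i) - 1) - ln 2))
    (euler_gamma - (harmonic (2 ^ n) - ln (2 ^ n) - / 2 ^ n))).
  apply is_lim_seq_ext with (1 := fun N => eq_sym (E N)).
  rewrite <- (HI n) at 1; fold (v n).
  apply is_lim_seq_minus'; [|apply is_lim_seq_const].
  assert (Hv : is_lim_seq v euler_gamma).
  { replace (Finite euler_gamma) with (Finite (euler_gamma - 0)) by (f_equal; ring).
    apply is_lim_seq_minus'.
    - apply (is_lim_seq_subseq _ _ (fun k => 2 ^ k)%nat) with (2 := is_lim_seq_euler_gamma).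
      intros P [N HN]; exists N; intros k Hk; apply HN.
      pose proof (Nat.pow_gt_lin_r 2 k); lia.
    - apply is_lim_seq_ext with (2 := is_lim_seq_pow_half 1).
      intros k; unfold Rdiv; ring. }
  apply (is_lim_seq_subseq v _ (fun N => n + 1 + N)%nat) with (2 := Hv).
  intros P [N HN]; exists N; intros k Hk; apply HN; lia.
Qed.

(** * The linear form in gamma and its size *)

Definition L_inner (n j : nat) : R :=
  sum_n_m (fun k => (-1) ^ (k - 1) / INR k * q_ln 2 (1 + INR k / 2 ^ n)) 1 (j - 1).

Lemma L_inner_0 (n : nat) : L_inner n 0 = 0.
Proof. unfold L_inner; rewrite sum_n_m_zero by lia; reflexivity. Qed.

Lemma L_inner_1 (n : nat) : L_inner n 1 = 0.
Proof. unfold L_inner; rewrite sum_n_m_zero by lia; reflexivity. Qed.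

Lemma L_inner_SS (n k : nat) : L_inner n (S (S k)) =
  L_inner n (S k) + (-1) ^ k / INR (S k) * q_ln 2 (1 + INR (S k) / 2 ^ n).
Proof.
  unfold L_inner; replace (S (S k) - 1)%nat with (S k) by lia.
  rewrite sum_n_Sm, !Nat.sub_succ, !Nat.sub_0_r by lia; reflexivity.
Qed.

Lemma sum_n_m_2 (f : nat -> R) (m : nat) :
  f 0%nat = 0 -> f 1%nat = 0 -> sum_n_m f 2 m = sum_f_R0 f m.
Proof.
  intros H0 H1; destruct m as [|m].
  { rewrite sum_n_m_zero by lia; easy. }
  induction m as [|m IH].
  { rewrite sum_n_m_zero by lia; simpl; rewrite H0, H1; symmetry; apply Rplus_0_r. }
  rewrite sum_n_Sm, IH by lia; reflexivity.
Qed.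

Lemma L_sumE (n m : nat) :
  L_sum n m = 2 ^ m * INR n * ln 2 + binomial_sum m (L_inner n).
Proof.
  rewrite binomial_sumE, <- sum_n_m_2; [reflexivity| |].
  - rewrite L_inner_0; ring.
  - rewrite L_inner_1; ring.
Qed.

(** Induction on [j] from Vacca's series: each step adds one reciprocal per dyadic block. Summed
    over the blocks, the first step gives 1/2^n, hence the [match], and the later ones give the
    q-logarithms of [L_inner]. *)
Lemma is_series_alt_harmonic_dyadic (n j : nat) : (j <= 2 ^ (n + 1))%nat ->
  is_series (fun i => alt_harmonic (2 ^ (n + 1 + i) - 1 + j) - ln 2)
    (euler_gamma - (harmonic (2 ^ n) - ln (2 ^ n) - / 2 ^ n) + L_inner n j
     - match j with O => 0 | S _ => / 2 ^ n end).
Proof.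
  induction j as [|j IH]; intros Hj.
  { rewrite L_inner_0, Rplus_0_r, Rminus_0_r.
    apply is_series_ext_R with (2 := is_series_vacca n).
    intros i; rewrite Nat.add_0_r; reflexivity. }
  assert (E : forall i, alt_harmonic (2 ^ (n + 1 + i) - 1 + S j) - ln 2 =
    alt_harmonic (2 ^ (n + 1 + i) - 1 + j) - ln 2 +
    - (-1) ^ j * / (2 ^ (n + 1 + i) + INR j)).
  { intros i; destruct (pow2_S_pred (n + 1 + i)) as [x Hx].
    assert (Hodd : (-1) ^ S x = 1).
    { rewrite <- Hx; replace (n + 1 + i)%nat with (S (n + i)) by lia.
      rewrite Nat.pow_succ_r'; apply pow_m1_double. }
    replace (2 ^ (n + 1 + i)) with (INR (S x)) by (rewrite <- Hx, pow_INR; reflexivity).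
    rewrite Hx, <- plus_INR; replace (S x - 1 + S j)%nat with (S (x + j)) by lia.
    replace (S x - 1 + j)%nat with (x + j)%nat by lia.
    rewrite alt_harmonic_S, pow_add; simpl in Hodd.
    replace ((-1) ^ x) with (-1) by lra; simpl (S x + j)%nat; unfold Rdiv; ring. }
  apply is_series_ext_R with (1 := fun i => eq_sym (E i)).
  specialize (IH ltac:(lia)).
  destruct j as [|k].
  - pose proof (is_series_plus_R _ _ _ _ IH
      (is_series_scal_R (-1) _ _ (is_series_inv_pow2 n))) as H.
    rewrite L_inner_0 in H; rewrite L_inner_1.
    match goal with |- is_series _ ?b =>
      match type of H with is_series _ ?a => replace b with a by ring end end.
    apply is_series_ext_R with (2 := H); intros i; simpl (INR 0); simpl ((-1) ^ 0).
    rewrite Rplus_0_r; ring.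
  - pose proof (is_series_plus_R _ _ _ _ IH
      (is_series_scal_R (- (-1) ^ S k) _ _
        (is_series_inv_pow2_plus n (S k) ltac:(lia)))) as H.
    match goal with |- is_series _ ?b =>
      match type of H with is_series _ ?a => replace b with a end end; [exact H|].
    rewrite L_inner_SS, <- tech_pow_Rmult; unfold Rdiv; ring.
Qed.

Lemma is_series_I_sum (n m : nat) : (m <= 2 ^ (n + 1))%nat ->
  is_series (fun i => S_sum (n + 1 + i) m) (I_sum n m).
Proof.
  intros Hm; apply Series_correct; eexists.
  apply is_series_ext_R with (fun i => binomial_sum m
    (fun j => alt_harmonic (2 ^ (n + 1 + i) - 1 + j) - ln 2)).
  - intros i; symmetry; apply S_sum_spec; lia.
  - apply (is_series_binomial_sum m
      (fun i j => alt_harmonic (2 ^ (n + 1 + i) - 1 + j) - ln 2)).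
    intros j Hj; apply is_series_alt_harmonic_dyadic; lia.
Qed.

(** The subtracted sum is 2^m H - 1/2^n with H = [harmonic (2 ^ n)], since j = 0 has binomial weight
    1. This is A_{n,m}, whose alternating sums telescope by Catalan's identity. *)
Lemma I_sumE (n m : nat) : (m <= 2 ^ (n + 1))%nat ->
  I_sum n m = L_sum n m + 2 ^ m * euler_gamma -
    binomial_sum m (fun j => harmonic (2 ^ n) -
      match j with O => / 2 ^ n | S _ => 0 end).
Proof.
  intros Hm; unfold I_sum.
  rewrite (Series_ext _ (fun i => binomial_sum m
    (fun j => alt_harmonic (2 ^ (n + 1 + i) - 1 + j) - ln 2)))
    by (intros i; apply S_sum_spec; lia).
  rewrite (is_series_unique _ _ (is_series_binomial_sum m
    (fun i j => alt_harmonic (2 ^ (n + 1 + i) - 1 + j) - ln 2) _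
    (fun j Hj => is_series_alt_harmonic_dyadic n j ltac:(lia)))).
  rewrite (binomial_sum_ext m _ (fun j => L_inner n j + (euler_gamma + INR n * ln 2)
    + (-1) * (harmonic (2 ^ n) - match j with O => / 2 ^ n | S _ => 0 end))).
  - rewrite !binomial_sum_plus, !binomial_sum_scal, !binomial_sum_const, L_sumE.
    change (fun j => L_inner n j) with (L_inner n); ring.
  - intros j _; rewrite ln_pow by lra; destruct j; ring.
Qed.

Lemma lcm_upto_div_integer (N l : nat) : (1 <= l <= N)%nat ->
  exists z, INR (lcm_upto N) * / INR l = IZR z.
Proof.
  intros Hl; destruct (divide_lcm_upto N l) as [q Hq]; try lia.
  exists (Z.of_nat q); rewrite Hq, mult_INR, <- INR_IZR_INZ.
  assert (0 < INR l) by (apply lt_0_INR; lia); field; lra.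
Qed.

Lemma lcm_upto_harmonic_integer (N K : nat) : (K <= N)%nat ->
  exists z, INR (lcm_upto N) * harmonic K = IZR z.
Proof.
  induction K as [|K IH]; intros HK.
  - exists 0%Z; rewrite harmonic_0; ring.
  - destruct IH as [z1 E1]; [lia|].
    destruct (lcm_upto_div_integer N (S K)) as [z2 E2]; [lia|].
    exists (z1 + z2)%Z; rewrite harmonic_S, plus_IZR, <- E1, <- E2; ring.
Qed.

(** The integer [z] is d A_{n,m}: all denominators in H and 1/2^n are at most 2^n, hence divide
    d. *)
Lemma linear_form_integer (n m : nat) : (m <= 2 ^ (n + 1))%nat ->
  exists z, INR (lcm_upto (2 ^ n)) * I_sum n m =
    INR (lcm_upto (2 ^ n)) * L_sum n m +
    INR (lcm_upto (2 ^ n) * 2 ^ m) * euler_gamma - IZR z.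
Proof.
  intros Hm; set (d := lcm_upto (2 ^ n)).
  assert (Hn : (1 <= 2 ^ n <= 2 ^ n)%nat) by (pose proof (Nat.pow_nonzero 2 n); lia).
  destruct (binomial_sum_integer m (fun j => INR d *
    (harmonic (2 ^ n) - match j with O => / 2 ^ n | S _ => 0 end))) as [z Hz].
  { destruct (lcm_upto_harmonic_integer (2 ^ n) (2 ^ n)) as [z1 E1]; [lia|].
    destruct (lcm_upto_div_integer (2 ^ n) (2 ^ n) Hn) as [z2 E2].
    rewrite pow_INR in E2; change (INR 2) with 2 in E2; fold d in E1, E2.
    intros [|j].
    - exists (z1 - z2)%Z; rewrite minus_IZR, <- E1, <- E2; ring.
    - exists z1; rewrite <- E1; ring. }
  exists z; rewrite <- Hz, binomial_sum_scal, I_sumE, mult_INR, pow_INR by exact Hm.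
  change (INR 2) with 2; ring.
Qed.

(** * Size of I_{n,m} and reciprocal binomial coefficients *)

(** Both sides are the reciprocal of the binomial coefficient C(x+m, m). *)
Lemma R_frac_INR (m x : nat) : (1 <= x)%nat ->
  INR x * R_frac m (INR x) = INR (fact m) * INR (fact x) / INR (fact (x + m)).
Proof.
  intros Hx; destruct x as [|x]; [lia|].
  assert (E : INR (fact x) * prod_f_R0 (fun i => INR (S x) + INR i) m =
    INR (fact (S x + m))).
  { induction m as [|m IH].
    - rewrite Nat.add_0_r, fact_simpl, mult_INR; cbn [prod_f_R0].
      change (INR 0) with 0; ring.
    - cbn [prod_f_R0]; rewrite <- Rmult_assoc, IH, <- plus_INR, Nat.add_succ_r.
      rewrite (fact_simpl (S x + m)), mult_INR; ring. }
  rewrite <- E, fact_simpl, mult_INR; unfold R_frac.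
  pose proof (prod_f_R0_pos m _ (INR_S_pos x)); pose proof (INR_fact_lt_0 x).
  field; lra.
Qed.

(** Raising y by one multiplies the reciprocal by (y+1)/(y+z+1) <= 1. It is applied both to the
    dyadic argument 2^nu and to [m]. *)
Lemma inv_binomial_decr (x y z : nat) : (x <= y)%nat ->
  INR (fact z) * INR (fact y) / INR (fact (y + z)) <=
  INR (fact z) * INR (fact x) / INR (fact (x + z)).
Proof.
  intros Hxy; induction Hxy as [|y Hxy IH]; [apply Rle_refl|].
  apply Rle_trans with (2 := IH); simpl (S y + z)%nat.
  rewrite !fact_simpl, !mult_INR, !S_INR, plus_INR.
  pose proof (INR_fact_lt_0 y); pose proof (INR_fact_lt_0 z).
  pose proof (INR_fact_lt_0 (y + z)); pose proof (pos_INR y); pose proof (pos_INR z).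
  set (a := INR (fact z) * INR (fact y) / INR (fact (y + z))).
  assert (0 < a) by (apply Rdiv_lt_0_compat; nra).
  replace (INR (fact z) * ((INR y + 1) * INR (fact y)) /
    ((INR y + INR z + 1) * INR (fact (y + z))))
    with (a * ((INR y + 1) / (INR y + INR z + 1))) by (unfold a; field; lra).
  rewrite <- (Rmult_1_r a) at 2; apply Rmult_le_compat_l; [lra|].
  apply Rle_div_l; lra.
Qed.

(** Each S_{nu,m} is at most R_m(2^nu) <= P/2^nu, where P is the value at nu = n + 1; these bounds
    add up to P/2^n <= P. *)
Lemma I_sum_bounds (n m : nat) : (m <= 2 ^ (n + 1))%nat ->
  0 <= I_sum n m <=
    INR (fact m) * INR (fact (2 ^ (n + 1))) / INR (fact (2 ^ (n + 1) + m)).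
Proof.
  intros Hm; set (P := _ / _).
  assert (HP : 0 < P).
  { apply Rdiv_lt_0_compat; [apply Rmult_lt_0_compat|]; apply INR_fact_lt_0. }
  assert (HB : forall i, 0 <= S_sum (n + 1 + i) m <= P * / 2 ^ (n + 1 + i)).
  { intros i; pose proof (S_sum_bounds (n + 1 + i) m ltac:(lia)) as [H1 H2].
    split; [exact H1|apply Rle_trans with (1 := H2)].
    assert (E : 2 ^ (n + 1 + i) = INR (2 ^ (n + 1 + i))) by (rewrite pow_INR; reflexivity).
    assert (Hle : (2 ^ (n + 1) <= 2 ^ (n + 1 + i))%nat) by (apply Nat.pow_le_mono_r; lia).
    pose proof (Nat.pow_nonzero 2 (n + 1 + i)).
    pose proof (inv_binomial_decr _ _ m Hle) as D; fold P in D.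
    rewrite <- R_frac_INR in D by lia.
    rewrite E in *; assert (0 < INR (2 ^ (n + 1 + i))) by (apply lt_0_INR; lia).
    apply -> (Rle_div_r (R_frac m (INR (2 ^ (n + 1 + i)))) P); lra. }
  pose proof (is_series_scal_R P _ _ (is_series_inv_pow2 n)) as HS.
  pose proof (is_series_I_sum n m Hm) as HI; split.
  - rewrite <- (is_series_unique _ _ HI).
    replace 0 with (Series (fun i => 0 * S_sum (n + 1 + i) m)) by (rewrite Series_scal_l; ring).
    apply Series_le; [intros i; specialize (HB i); lra|eexists; apply HI].
  - apply Rle_trans with (P * / 2 ^ n).
    + rewrite <- (is_series_unique _ _ HI), <- (is_series_unique _ _ HS).
      apply Series_le; [apply HB|eexists; apply HS].
    + pose proof (pow2_ge_1 n); rewrite <- (Rmult_1_r P) at 2.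
      apply Rmult_le_compat_l; [lra|].
      rewrite <- Rinv_1; apply Rinv_le_contravar; lra.
Qed.

(** C(5M, M) grows like (5^5/4^4)^M up to a polynomial factor, and 5^5/4^4 > 12. The square leaves
    room for induction from M = 0. *)
Lemma fact_5M_lower_bound (M : nat) :
  INR (fact M) * INR (fact (4 * M)) * 12 ^ M <= (INR M + 1) ^ 2 * INR (fact (5 * M)).
Proof.
  induction M as [|M IH]; [simpl; lra|].
  replace (4 * S M)%nat with (S (S (S (S (4 * M))))) by lia.
  replace (5 * S M)%nat with (S (S (S (S (S (5 * M)))))) by lia.
  rewrite !fact_simpl, !mult_INR, !S_INR, (mult_INR 4), (mult_INR 5).
  replace (INR 4) with 4 by (simpl; ring); replace (INR 5) with 5 by (simpl; ring).
  pose proof (pos_INR M) as Hx; set (x := INR M) in *.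
  set (a := INR (fact M) * INR (fact (4 * M)) * 12 ^ M) in *.
  set (b := INR (fact (5 * M))) in *.
  assert (Hb : 0 < b) by apply INR_fact_lt_0.
  match goal with |- ?l <= _ => replace l with
    (12 * (x+1) * (4*x+1+1+1+1) * (4*x+1+1+1) * (4*x+1+1) * (4*x+1) * a)
    by (unfold a; simpl; ring) end.
  apply Rle_trans with
    (12 * (x+1) * (4*x+1+1+1+1) * (4*x+1+1+1) * (4*x+1+1) * (4*x+1) * ((x + 1) ^ 2 * b)).
  - apply Rmult_le_compat_l; [|exact IH].
    repeat apply Rmult_le_pos; lra.
  (* The difference of the two sides factors into terms with nonnegative coefficients; the leading
     one is 53 = 5^5 - 12 4^4. *)
  - apply Rminus_le, Ropp_le_cancel; rewrite Ropp_0.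
    match goal with |- 0 <= ?l => replace l with (b * (x + 1) *
      (53 * x^6 + 4926 * x^5 + 16723 * x^4 + 20230 * x^3 + 10812 * x^2 + 2504 * x + 192))
      by ring end.
    repeat (apply Rplus_le_le_0_compat || apply Rmult_le_pos || apply pow_le); lra.
Qed.

(** * The numerical comparison 432^2 < 12^5 *)

Lemma pow_lt_1_inv (x : R) (k : nat) : 0 <= x -> x ^ k < 1 -> x < 1.
Proof.
  intros H0 H; destruct (Rlt_le_dec x 1) as [|H1]; [assumption|].
  pose proof (pow_R1_Rle x k H1); lra.
Qed.

Lemma exponential_beats_polynomial (p : nat) : (15 <= p)%nat ->
  2 ^ (10 * S p * (S p + 1) + 10 * S p) * 3 ^ (2 ^ p) < 4 ^ (2 ^ p).
Proof.
  intros Hp; set (q := (10 * S p * (S p + 1) + 10 * S p)%nat).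
  (* Since (4/3)^3 > 2, the bound 3(q+1) <= 2^p is enough. *)
  assert (Hq : (3 * S q <= 2 ^ p)%nat).
  { unfold q; clear q; induction Hp as [|p Hp IH].
    - apply Nat.leb_le; vm_compute; reflexivity.
    - rewrite Nat.pow_succ_r'; nia. }
  assert (H : 2 ^ S q <= (4 / 3) ^ (2 ^ p)).
  { apply Rle_trans with ((4 / 3) ^ (3 * S q)).
    - rewrite pow_mult; apply pow_incr; simpl; lra.
    - apply Rle_pow; [lra|exact Hq]. }
  replace (4 ^ (2 ^ p)) with ((4 / 3) ^ (2 ^ p) * 3 ^ (2 ^ p))
    by (rewrite <- Rpow_mult_distr; f_equal; field).
  apply Rmult_lt_compat_r; [apply pow_lt; lra|].
  pose proof (pow2_ge_1 q); change (2 ^ S q) with (2 * 2 ^ q) in H; lra.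
Qed.

(** The product is compared with 1 through its fifth power, as Chebyshev's estimate bounds the fifth
    power of the lcm. What remains is the ratio 12^5/432^2 = 4/3 against powers of 2 with exponent
    quadratic in p. *)
Lemma lcm_upto_inv_binomial (p : nat) : (15 <= p)%nat ->
  INR (lcm_upto (2 ^ S p)) * (INR (fact (2 ^ p)) * INR (fact (4 * 2 ^ p)) /
    INR (fact (5 * 2 ^ p))) < 1.
Proof.
  intros Hp; pose proof (exponential_beats_polynomial p Hp) as Hmain.
  assert (Hlcm : INR (lcm_upto (2 ^ S p)) ^ 5 <=
    (2 ^ (S p + 1)) ^ (10 * S p) * 432 ^ (2 ^ S p)).
  { replace ((2 ^ (S p + 1)) ^ (10 * S p) * 432 ^ (2 ^ S p)) with
      (INR ((2 ^ (S p + 1)) ^ (10 * S p) * 432 ^ (2 ^ S p)))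
      by (rewrite mult_INR, !pow_INR, (INR_IZR_INZ 2), (INR_IZR_INZ 432); reflexivity).
    rewrite <- pow_INR; apply le_INR.
    (* The depth e = p + 1 works because 2^(p+1) < 6^(p+1). *)
    apply Nat.le_trans with (1 := ChebyshevBound.lcm_upto_pow_le (S p) (2 ^ S p)
      ltac:(apply Nat.pow_lt_mono_l; lia)).
    apply Nat.mul_le_mono_r, Nat.pow_le_mono_l.
    rewrite Nat.add_1_r, (Nat.pow_succ_r' 2 (S p)).
    pose proof (Nat.pow_nonzero 2 (S p)); lia. }
  set (d := INR (lcm_upto (2 ^ S p))) in *.
  rewrite Nat.pow_succ_r' in Hlcm.
  assert (HM : INR (2 ^ p) = 2 ^ p) by (rewrite pow_INR; reflexivity).
  pose proof (fact_5M_lower_bound (2 ^ p)) as HB; rewrite HM in HB.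
  set (M := (2 ^ p)%nat) in *.
  set (P := _ / _).
  assert (H12 : 0 < 12 ^ M) by (apply pow_lt; lra).
  assert (HP : 0 < P).
  { apply Rdiv_lt_0_compat; [apply Rmult_lt_0_compat|]; apply INR_fact_lt_0. }
  assert (HP' : P <= 2 ^ (2 * S p) / 12 ^ M).
  { apply -> Rle_div_r; [|exact H12].
    apply Rle_trans with ((2 ^ p + 1) ^ 2).
    - apply Rmult_le_reg_r with (INR (fact (5 * M))); [apply INR_fact_lt_0|].
      apply Rle_trans with (2 := HB); apply Req_le; unfold P; field.
      apply INR_fact_neq_0.
    - rewrite Nat.mul_comm, pow_mult; apply pow_incr.
      pose proof (pow2_ge_1 p); simpl; lra. }
  assert (Hd : 0 <= d) by apply pos_INR.
  apply pow_lt_1_inv with 5%nat; [nra|].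
  rewrite Rpow_mult_distr.
  apply Rle_lt_trans with ((2 ^ (S p + 1)) ^ (10 * S p) * 432 ^ (2 * M) *
    (2 ^ (2 * S p) / 12 ^ M) ^ 5).
  - apply Rmult_le_compat; [apply pow_le, Hd|apply pow_le; lra|exact Hlcm|].
    apply pow_incr; lra.
  - unfold Rdiv; rewrite Rpow_mult_distr, pow_inv, <- !pow_mult.
    rewrite <- Rmult_assoc; apply Rlt_div_l; [apply pow_lt; lra|].
    (* 62208 is the common factor: 12^5 = 4 · 62208 and 432^2 = 3 · 62208. *)
    replace (12 ^ (M * 5)) with (4 ^ M * 62208 ^ M)
      by (rewrite <- Rpow_mult_distr, (Nat.mul_comm M 5), pow_mult; f_equal; simpl; ring).
    replace (432 ^ (2 * M)) with (3 ^ M * 62208 ^ M)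
      by (rewrite <- Rpow_mult_distr, pow_mult; f_equal; simpl; ring).
    apply Rmult_lt_compat_r with (r := 62208 ^ M) in Hmain; [|apply pow_lt; lra].
    rewrite pow_add in Hmain.
    replace (2 * S p * 5)%nat with (10 * S p)%nat by lia.
    replace ((S p + 1) * (10 * S p))%nat with (10 * S p * (S p + 1))%nat by ring.
    rewrite Rmult_1_l; apply Rle_lt_trans with (2 := Hmain); apply Req_le; ring.
Qed.

Theorem theorem2 :
  is_rational euler_gamma <->
  exists N : nat, forall n m : nat,
    (N <= n)%nat ->
    (2 ^ (n - 1) <= m <= 2 ^ (n + 1))%nat ->
    frac_part (INR (lcm_upto (2 ^ n)) * L_sum n m) =
    INR (lcm_upto (2 ^ n)) * I_sum n m.
Proof.
  split.
  - intros [[a b] E]; unfold Q2R in E; cbn [QArith_base.Qnum QArith_base.Qden] in E.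
    (* 16 gives p = n - 1 >= 15 for the size estimate; n >= b gives b < 2^n, so that b divides d. *)
    exists (Nat.max 16 (Pos.to_nat b)); intros n m Hn Hm.
    destruct (linear_form_integer n m ltac:(lia)) as [z Hz].
    assert (Hint : exists y,
      INR (lcm_upto (2 ^ n) * 2 ^ m) * euler_gamma = IZR y).
    { destruct (divide_lcm_upto (2 ^ n) (Pos.to_nat b)) as [q Hq]; [lia| |].
      - pose proof (Nat.pow_gt_lin_r 2 n); lia.
      - exists (a * Z.of_nat (q * 2 ^ m))%Z.
        assert (0 < IZR (Z.pos b)) by (apply IZR_lt; lia).
        rewrite Hq, E, mult_IZR, <- INR_IZR_INZ, !mult_INR.
        rewrite (INR_IZR_INZ (Pos.to_nat b)), positive_nat_Z; field; lra. }
    destruct Hint as [y Hy].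
    destruct (I_sum_bounds n m ltac:(lia)) as [H0 H1].
    destruct n as [|p]; [lia|].
    pose proof (lcm_upto_inv_binomial p ltac:(lia)) as Hlt.
    replace (S p - 1)%nat with p in Hm by lia.
    replace (2 ^ (S p + 1))%nat with (4 * 2 ^ p)%nat in H1
      by (rewrite Nat.add_1_r, !Nat.pow_succ_r'; ring).
    (* The lower bound m >= 2^p enters here and reduces the estimate to m = 2^p. *)
    pose proof (inv_binomial_decr _ _ (4 * 2 ^ p) (proj1 Hm)) as Hdecr.
    replace (4 * 2 ^ p + m)%nat with (m + 4 * 2 ^ p)%nat in H1 by lia.
    replace (2 ^ p + 4 * 2 ^ p)%nat with (5 * 2 ^ p)%nat in Hdecr by lia.
    set (d := INR (lcm_upto (2 ^ S p))) in *.
    assert (Hd : 0 <= d) by apply pos_INR.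
    (* A number in [0, 1) that differs from d L by an integer is its fractional part. *)
    symmetry; apply (Int_part_frac_part_spec (d * L_sum (S p) m) (z - y)).
    + split; [apply Rmult_le_pos; assumption|].
      apply Rle_lt_trans with (2 := Hlt), Rmult_le_compat_l; [exact Hd|].
      rewrite (Rmult_comm (INR (fact (2 ^ p)))), (Rmult_comm (INR (fact m))) in *; lra.
    + rewrite Hz, Hy, minus_IZR; ring.
  - intros [N HN].
    (* One admissible pair suffices: the fractional part is x minus an integer, so x cancels and k
       gamma is an integer. *)
    specialize (HN N (2 ^ (N + 1))%nat (le_n N)).
    destruct (linear_form_integer N (2 ^ (N + 1)) (le_n _)) as [z Hz].
    rewrite <- HN in Hz by (split; [apply Nat.pow_le_mono_r; lia|lia]).
    set (x := INR _ * L_sum _ _) in Hz.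
    set (k := (lcm_upto (2 ^ N) * 2 ^ 2 ^ (N + 1))%nat) in Hz.
    assert (Hk : (0 < k)%nat).
    { apply Nat.mul_pos_pos; [apply lcm_upto_pos|].
      pose proof (Nat.pow_nonzero 2 (2 ^ (N + 1))); lia. }
    exists (QArith_base.Qmake (z - Int_part x) (Pos.of_nat k)); unfold Q2R; cbn [QArith_base.Qnum QArith_base.Qden].
    rewrite <- positive_nat_Z, Nat2Pos.id, <- INR_IZR_INZ, minus_IZR by lia.
    unfold frac_part in Hz; apply lt_0_INR in Hk.
    apply Rmult_eq_reg_l with (INR k); [|lra].
    rewrite <- Rmult_assoc, (Rmult_comm (INR k) (_ - _)), Rmult_assoc, Rinv_r by lra.
    lra.
Qed.
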